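(* For every $n\in\mathbb{N}=\{1,2,\dots\}$, $$\mathrm{gap}_2(n)=\left\lceil n/2\right\rceil-\alpha(n)+\varepsilon(n),$$ where $\varepsilon(n)=1$ if $n$ is an even Ramsey number or $n$ is Ramsey-perfect, and $\varepsilon(n)=0$ otherwise.
   Context: All graphs are finite, simple and undirected. $\alpha(G)$ denotes the maximum size of a stable (independent) set, $\theta(G)$ the clique cover number, i.e. the minimum number of cliques partitioning $V(G)$. The gap of $G$ is $\mathrm{gap}(G)=\theta(G)-\alpha(G)$. $R(3,m)$ is the Ramsey number: the smallest $N$ such that every graph on $N$ vertices has a triangle or a stable set of size $m$; so $R(3,1)=1$, $R(3,2)=3$, $R(3,3)=6,\dots$. A ''Ramsey number'' means a number of the form $R(3,m)$ for some $m\in\mathbb{N}$. For $n\in\mathbb{N}$, $\alpha(n)$ is the minimum of $\alpha(G)$ over triangle-free graphs $G$ on $n$ vertices; equivalently, it is the integer with $R(3,\alpha(n))\le n<R(3,\alpha(n)+1)$. $\mathrm{gap}_2(n)$ is the maximum of $\mathrm{gap}(G)$ over triangle-free graphs $G$ on $n$ vertices. A number $n$ is Ramsey-perfect if $n$ is not an even Ramsey number and $n=n_1+n_2$ with $n_1,n_2\ge 5$ odd and $\alpha(n)=\alpha(n_1)+\alpha(n_2)$. *)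

(* Defs.v *)
From HB Require Import structures.
From mathcomp Require Import all_boot all_order all_algebra.
From mathcomp Require Import boolp.

Set Implicit Arguments.
Unset Strict Implicit.
Unset Printing Implicit Defensive.

Import Order.TTheory GRing.Theory Num.Theory.

Record sgraph (T : finType) := SGraph {
  edges : {set {set T}};
  edges_card2 : [forall e in edges, #|e| == 2]
}.

HB.instance Definition _ (T : finType) := [isSub for @edges T].
HB.instance Definition _ (T : finType) := [Finite of sgraph T by <:].

Section Graph.
Variable T : finType.
Implicit Types (G : sgraph T) (S K : {set T}) (P : {set {set T}}).

Definition adj G : rel T := fun x y => [set x; y] \in edges G.

Lemma adj_sym G : symmetric (adj G).
Proof. by move=> x y; rewrite /adj setUC. Qed.

Lemma adj_irrefl G : irreflexive (adj G).
Proof.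
move=> x; apply/negP => /(forall_inP (edges_card2 G)).
by rewrite setUid cards1.
Qed.

Definition stable G S := [forall x in S, forall y in S, ~~ adj G x y].

Definition clique G K := [forall x in K, forall y in K, (x != y) ==> adj G x y].

Definition has_triangle G :=
  [exists x, exists y, exists z, [&& adj G x y, adj G y z & adj G x z]].

Definition triangle_free G := ~~ has_triangle G.

Definition alpha G : nat := \max_(S : {set T} | stable G S) #|S|.

Definition clique_cover G P :=
  partition P [set: T] && [forall K in P, clique G K].

Definition singletons : {set {set T}} := [set [set x] | x : T].

(* In each [arg min] / [arg max] below, the default value satisfies the side
   condition, so the value is a genuine minimum / maximum. *)
Lemma singletons_clique_cover G : clique_cover G singletons.
Proof.
apply/andP; split.
  apply/and3P; split.
  - apply/eqP/setP => x; rewrite inE; apply/bigcupP; exists [set x].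
      exact: imset_f.
    by rewrite inE.
  - apply/trivIsetP => _ _ /imsetP[x _ ->] /imsetP[y _ ->] neq.
    by rewrite disjoints1 inE; apply: contra neq => /eqP ->.
  - by apply/imsetP => -[x _ /setP/(_ x)]; rewrite !inE eqxx.
apply/forall_inP => _ /imsetP[x _ ->].
apply/forall_inP => y /set1P ->; apply/forall_inP => z /set1P ->.
by rewrite eqxx.
Qed.

Definition theta G : nat :=
  #|[arg min_(P < singletons | clique_cover G P) #|P| ]|.

Definition gap G : int := ((theta G)%:Z - (alpha G)%:Z)%R.

Fact edgeless_card2 : [forall e in (set0 : {set {set T}}), #|e| == 2].
Proof. by apply/forall_inP => e; rewrite inE. Qed.

Definition edgeless : sgraph T := SGraph edgeless_card2.

Lemma edgeless_triangle_free : triangle_free edgeless.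
Proof.
apply/existsPn => x; apply/existsPn => y; apply/existsPn => z.
by rewrite /adj inE.
Qed.

Lemma triangle_free_stable_nbhd G x :
  triangle_free G -> stable G [set y | adj G x y].
Proof.
move=> tf; apply/forall_inP => y; rewrite inE => xy.
apply/forall_inP => z; rewrite inE => xz; apply: contra tf => yz.
apply/existsP; exists x; apply/existsP; exists y; apply/existsP; exists z.
by rewrite xy yz.
Qed.

Lemma stable_sub G S S' : S' \subset S -> stable G S -> stable G S'.
Proof.
move=> /subsetP sS /forall_inP st; apply/forall_inP => x /sS/st/forall_inP stx.
by apply/forall_inP => y /sS/stx.
Qed.

Lemma stable_card G S m :
  stable G S -> m <= #|S| -> exists2 S' : {set T}, stable G S' & #|S'| = m.
Proof.
move=> st /card_geqP[s [us ss sS]]; exists [set x in s].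
  by apply: stable_sub st; apply/subsetP => x; rewrite inE => /sS.
by rewrite cardsE (card_uniqP us).
Qed.

Lemma triangle_free_stable_greedy G m k (A : {set T}) :
  0 < m -> (forall x, #|[set y | adj G x y]| < m) -> k * m <= #|A| ->
  exists2 S : {set T}, S \subset A & stable G S && (k <= #|S|).
Proof.
move=> m_gt0 deg; elim: k A => [|k IH] A leA.
  exists set0; first exact: sub0set.
  by rewrite andbT; apply/forall_inP => x; rewrite inE.
have [x xA] : exists x, x \in A.
  by apply/card_gt0P; apply: leq_trans leA; rewrite muln_gt0.
pose N := x |: [set y | adj G x y].
have leN : #|N| <= m.
  by apply: leq_trans (deg x); rewrite cardsU1 -add1n leq_add2r leq_b1.
have [|S SA /andP[st kS]] := IH (A :\: N).
  rewrite cardsD -(leq_add2r m); apply: leq_trans (_ : #|A| <= _).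
    by rewrite addnC -mulSn.
  rewrite addnC -leq_subLR leq_sub2l // (leq_trans _ leN) //.
  by rewrite subset_leq_card // subsetIr.
have /subsetP SN := SA.
have xS : x \notin S by apply/negP => /SN; rewrite !inE eqxx.
have nadj y : y \in S -> ~~ adj G x y.
  by move=> /SN; rewrite !inE negb_or => /andP[/andP[]].
exists (x |: S).
  by rewrite subUset sub1set xA (subset_trans SA) // subsetDl.
rewrite cardsU1 xS add1n ltnS kS andbT.
apply/forall_inP => y /setU1P[->|yS]; apply/forall_inP => z /setU1P[->|zS].
- by rewrite adj_irrefl.
- exact: nadj.
- by rewrite adj_sym nadj.
- by move/forall_inP: st => /(_ _ yS)/forall_inP; apply.
Qed.

Lemma triangle_or_stable G m :
  m * m <= #|T| ->
  has_triangle G || [exists S : {set T}, stable G S && (#|S| == m)].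
Proof.
move=> leT; case: (boolP (has_triangle G)) => //= tf.
suff [S st mS] : exists2 S : {set T}, stable G S & m <= #|S|.
  have [S' st' <-] := stable_card st mS.
  by apply/existsP; exists S'; rewrite st' eqxx.
case: m leT => [|m] leT.
  by exists set0 => //; apply/forall_inP => x; rewrite inE.
case: (boolP [exists x, m < #|[set y | adj G x y]|]) => [/existsP[x mx]|].
  by exists [set y | adj G x y] => //; apply: triangle_free_stable_nbhd.
move=> /existsPn deg.
have [x||S _ /andP[]] := @triangle_free_stable_greedy G m.+1 m.+1 [set: T] isT.
- by rewrite ltnS leqNgt.
- by rewrite cardsT.
- by exists S.
Qed.

End Graph.

Definition ramsey3_prop (m N : nat) : bool :=
  [forall G : sgraph 'I_N,
    has_triangle G || [exists S : {set 'I_N}, stable G S && (#|S| == m)]].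

Lemma ramsey3_exists m : exists N, ramsey3_prop m N.
Proof.
exists (m * m); apply/forallP => G.
by apply: triangle_or_stable; rewrite card_ord.
Qed.

Definition R3 (m : nat) : nat := ex_minn (ramsey3_exists m).

Definition ramsey_number (n : nat) : Prop := exists2 m, 0 < m & R3 m = n.

Definition even_ramsey_number (n : nat) : Prop := ~~ odd n /\ ramsey_number n.

Definition alpha_min (n : nat) : nat :=
  alpha [arg min_(G < edgeless 'I_n | triangle_free G) alpha G].

Definition gap2 (n : nat) : int :=
  gap [arg max_(G > edgeless 'I_n | triangle_free G) gap G]%O.

Definition ramsey_perfect (n : nat) : Prop :=
  ~ even_ramsey_number n /\
  exists n1 n2 : nat,
    [/\ n = n1 + n2, 5 <= n1, 5 <= n2, odd n1 /\ odd n2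
      & alpha_min n = alpha_min n1 + alpha_min n2].

Definition eps (n : nat) : nat :=
  if `[< even_ramsey_number n \/ ramsey_perfect n >] then 1 else 0.

(* Main.v *)
Require Import Defs.
From mathcomp Require Import all_boot all_order all_algebra.
From mathcomp Require Import boolp zify.

(* In a triangle-free graph the clique cover number is the order minus the size
   of a maximum matching, so the upper bound amounts to a large matching and a
   large stable set. By induction over induced subgraphs: either some vertex is
   covered by all maximum matchings and can be deleted, or by Gallai's lemma the
   graph falls apart into two pieces or has a matching missing at most one
   vertex. The induction goes through because the right-hand side of the formula
   is superadditive in the order. That rests on a Ramsey construction: two
   triangle-free graphs with stability numbers a and b can be joined, with
   min(a, b) additional vertices, into one of stability number at most a + b.
   For the lower bound take a triangle-free graph with minimum stability number,
   or the disjoint union of two such graphs of odd order when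
   alpha(n) = alpha(n1) + alpha(n2); an even Ramsey number n is the case n2 = 1. *)

Set Implicit Arguments.
Unset Strict Implicit.
Unset Printing Implicit Defensive.

(** * Graphs from relations, stable sets, induced graphs *)

Section RelGraph.
Variables (T : finType) (e : rel T).

Definition rel_edges : {set {set T}} :=
  [set [set p.1; p.2] | p in [pred p : T * T | e p.1 p.2 && (p.1 != p.2)]].

Fact rel_edges_card2 : [forall E in rel_edges, #|E| == 2].
Proof.
apply/forall_inP => _ /imsetP[[x y] /= /andP[_ ne] ->].
by rewrite cards2 ne.
Qed.

Definition rel_graph : sgraph T := SGraph rel_edges_card2.

Lemma adj_rel_graph : symmetric e -> irreflexive e -> adj rel_graph =2 e.
Proof.
move=> es ei x y; apply/imsetP/idP => [[[u v] /= /andP[/= euv ne] E]|exy]; last first.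
  exists (x, y) => //=; rewrite inE /= exy /=.
  by apply: contraTneq exy => ->; rewrite ei.
move/setP: E => E; have := E u; have := E v; have := E x; have := E y.
rewrite !inE !eqxx !orbT /= => /esym/orP[]/eqP-> /esym/orP[]/eqP->.
- by rewrite orbb eq_sym (negPf ne).
- by rewrite es.
- by [].
- by rewrite orbb (negPf ne).
Qed.

End RelGraph.

Section Basics.
Variable T : finType.
Implicit Types (G : sgraph T) (S A : {set T}).

Lemma stableP G S : reflect {in S &, forall x y, ~~ adj G x y} (stable G S).
Proof.
apply: (iffP forall_inP) => [H x y /H/forall_inP|H x xS]; first exact.
by apply/forall_inP => y; apply: H.
Qed.

Lemma triangle_freeP G :
  reflect (forall x y z, adj G x y -> adj G y z -> adj G x z -> False)
          (triangle_free G).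
Proof.
apply: (iffP idP) => [/existsPn H x y z xy yz xz|H].
  by move: (H x) => /existsPn/(_ y)/existsPn/(_ z); rewrite xy yz xz.
apply/existsP => -[x /existsP[y /existsP[z /and3P[]]]]; exact: H.
Qed.

Lemma stable_alpha G S : stable G S -> #|S| <= alpha G.
Proof. exact: (@leq_bigmax_cond _ (stable G) (fun S => #|S|)). Qed.

Lemma alpha_leP G k :
  reflect (forall S, stable G S -> #|S| <= k) (alpha G <= k).
Proof. exact: bigmax_leqP. Qed.

Lemma alpha_attained G : exists2 S, stable G S & #|S| = alpha G.
Proof.
have s0 : stable G set0 by apply/stableP => x y; rewrite inE.
by rewrite /alpha (bigmax_eq_arg set0) //; case: arg_maxnP => // S st _; exists S.
Qed.

End Basics.

Section Pullback.
Variables (U T : finType) (f : U -> T) (G : sgraph T).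

Definition pullback : sgraph U := rel_graph (relpre f (adj G)).

Lemma adj_pullback x y : adj pullback x y = adj G (f x) (f y).
Proof.
by rewrite adj_rel_graph // => [u v|u] /=; rewrite ?adj_irrefl // adj_sym.
Qed.

Lemma pullback_triangle_free : triangle_free G -> triangle_free pullback.
Proof.
move=> /triangle_freeP tf; apply/triangle_freeP => x y z.
rewrite !adj_pullback; exact: tf.
Qed.

Lemma stable_pullback (S : {set U}) : stable pullback S = stable G (f @: S).
Proof.
apply/stableP/stableP => [st _ _ /imsetP[x xS ->] /imsetP[y yS ->]|st x y xS yS].
  by rewrite -adj_pullback st.
by rewrite adj_pullback st ?imset_f.
Qed.

End Pullback.

(** * The minimum stability number of triangle-free graphs *)

Lemma alpha_minP n :
  exists2 G : sgraph 'I_n, triangle_free G & alpha G = alpha_min n.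
Proof.
rewrite /alpha_min; case: arg_minnP => [|G tf _]; first exact: edgeless_triangle_free.
by exists G.
Qed.

Lemma alpha_min_stable (T : finType) (G : sgraph T) (A : {set T}) :
  triangle_free G ->
  exists S : {set T}, [/\ S \subset A, stable G S & alpha_min #|A| <= #|S|].
Proof.
move=> tf; pose g := enum_val : 'I_#|A| -> T.
have [S st cS] := alpha_attained (pullback g G).
exists (g @: S); split; last 1 first.
- rewrite card_imset ?cS; last exact: enum_val_inj.
  rewrite /alpha_min; case: arg_minnP => [|H _ ->] //.
    exact: edgeless_triangle_free.
  exact: pullback_triangle_free.
- by apply/subsetP => _ /imsetP[i _ ->]; apply: enum_valP.
- by rewrite -stable_pullback.
Qed.

Lemma alpha_min_le (T : finType) (G : sgraph T) k :
  triangle_free G -> (forall S, stable G S -> #|S| <= k) -> alpha_min #|T| <= k.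
Proof.
move=> tf H; rewrite -cardsT; have [S [_ st le]] := alpha_min_stable setT tf.
exact: leq_trans le (H _ st).
Qed.

Lemma leq_alpha_min m n : m <= n -> alpha_min m <= alpha_min n.
Proof.
move=> le; have [G tf <-] := alpha_minP n.
pose A := [set widen_ord le i | i : 'I_m].
have cA : #|A| = m by rewrite card_imset ?card_ord // => i j /(congr1 val) /= /ord_inj.
rewrite -{1}cA; have [S [_ st leS]] := alpha_min_stable A tf.
exact: leq_trans leS (stable_alpha st).
Qed.

Lemma alpha_min0 : alpha_min 0 = 0.
Proof.
have [G _ <-] := alpha_minP 0; apply/eqP; rewrite -leqn0; apply/alpha_leP => S _.
by rewrite (leq_trans (max_card _)) ?card_ord.
Qed.

Lemma alpha_min_gt0 n : 0 < n -> 0 < alpha_min n.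
Proof.
case: n => // n _; have [G tf <-] := alpha_minP n.+1.
rewrite -(cards1 (@ord0 n)); apply: stable_alpha; apply/stableP => x y.
by move=> /set1P-> /set1P->; rewrite adj_irrefl.
Qed.

Lemma alpha_min1 : alpha_min 1 = 1.
Proof.
apply/eqP; rewrite eqn_leq alpha_min_gt0 // andbT.
have [G _ <-] := alpha_minP 1; apply/alpha_leP => S _.
by rewrite (leq_trans (max_card _)) ?card_ord.
Qed.

Lemma alpha_min2 : alpha_min 2 <= 1.
Proof.
rewrite -card_bool; apply: (@alpha_min_le _ (rel_graph (fun x y : bool => x != y))).
  apply/triangle_freeP => x y z; rewrite !adj_rel_graph; first by case: x y z => -[] [].
  1,3,5: by move=> u v; rewrite eq_sym.
  1-3: by move=> u; rewrite eqxx.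
move=> S /stableP st; apply/card_le1P => x xS y; rewrite inE.
apply/idP/eqP => [yS|->//]; have := st y x yS xS.
rewrite adj_rel_graph => [/negPn/eqP//|u v|u]; by rewrite ?eqxx // eq_sym.
Qed.

Lemma alpha_min_ge2 n : 2 < n -> 1 < alpha_min n.
Proof.
move=> n_gt2; apply: leq_trans (leq_alpha_min n_gt2).
have [G /triangle_freeP tf <-] := alpha_minP 3.
suff [x [y [ne nadj]]] : exists x y, x != y /\ ~~ adj G x y.
  have c2 : #|[set x; y]| = 2 by rewrite cards2 ne.
  apply: (leq_trans (_ : _ <= #|[set x; y]|)); first by rewrite c2.
  apply: stable_alpha; apply/stableP => u v /set2P[]-> /set2P[]->;
    by rewrite ?adj_irrefl // adj_sym.
pose i k : 'I_3 := inord k.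
have ne u v : u < 3 -> v < 3 -> u != v -> i u != i v.
  by move=> lu lv; apply: contra => /eqP/(congr1 val); rewrite /= !inordK // => ->.
case E01 : (adj G (i 0) (i 1)); last by exists (i 0), (i 1); rewrite E01 ne.
case E12 : (adj G (i 1) (i 2)); last by exists (i 1), (i 2); rewrite E12 ne.
case E02 : (adj G (i 0) (i 2)); last by exists (i 0), (i 2); rewrite E02 ne.
by have := tf _ _ _ E01 E12 E02.
Qed.

(** Delete a vertex and its neighbourhood: the latter is stable, hence has at most [alpha_min n]
    vertices, and a stable set of the rest extends by the vertex. *)
Lemma alpha_min_remove n :
  0 < n -> (alpha_min (n - (alpha_min n).+1)).+1 <= alpha_min n.
Proof.
case: n => // n _; have [G tf aG] := alpha_minP n.+1.
pose N := [set y | adj G ord0 y]; pose A := ~: (ord0 |: N).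
have leN : #|N| <= alpha_min n.+1.
  by rewrite -aG; apply: stable_alpha; apply: triangle_free_stable_nbhd.
have leA : n.+1 - (alpha_min n.+1).+1 <= #|A|.
  have := cardsC (ord0 |: N); rewrite card_ord cardsU1 -/A.
  have := leq_b1 (ord0 \notin N); move: leN.
  move: #|N| #|A| (nat_of_bool _) => a b c; lia.
have [S [/subsetP sSA /stableP st leS]] := alpha_min_stable A tf.
have S0 x : x \in S -> x != ord0 /\ ~~ adj G ord0 x.
  by move=> /sSA; rewrite !inE negb_or => /andP[].
have: #|ord0 |: S| <= alpha_min n.+1.
  rewrite -aG; apply: stable_alpha; apply/stableP => x y /setU1P[->|xS] /setU1P[->|yS].
  - by rewrite adj_irrefl.
  - by case: (S0 y yS).
  - by rewrite adj_sym; case: (S0 x xS).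
  - exact: st.
have nS : ord0 \notin S by apply/negP => /S0[]; rewrite eqxx.
rewrite cardsU1 nS; have := leq_alpha_min leA; lia.
Qed.

(** * The Ramsey construction *)

Lemma leq_card_sum_set (A B : finType) (S : {set A + B}) :
  #|S| <= #|[set x | inl x \in S]| + #|[set y | inr y \in S]|.
Proof.
set S1 := [set x | _]; set S2 := [set y | _].
have sub : S \subset (inl @: S1) :|: (inr @: S2).
  by apply/subsetP => -[x|y] xS; rewrite inE imset_f ?orbT // inE.
rewrite (leq_trans (subset_leq_card sub)) // (leq_trans (leq_card_setU _ _)) //.
by rewrite !card_imset //; [move=> x y []|move=> x y []].
Qed.

Lemma stable_extend (T I : finType) (G : sgraph T) (u : I -> T)
    (S : {set T}) (J : {set I}) :
  injective u -> (forall i j, ~~ adj G (u i) (u j)) -> stable G S ->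
  (forall i x, i \in J -> x \in S -> ~~ adj G (u i) x) ->
  #|S| + #|[set i in J | u i \notin S]| <= alpha G.
Proof.
move=> u_inj u_st /stableP sS nJ; set K := [set i in J | _].
rewrite -(card_imset K u_inj).
have -> : #|S| + #|u @: K| = #|S :|: u @: K|.
  rewrite cardsU; have -> : S :&: u @: K = set0; last by rewrite cards0 subn0.
  apply/setP => x; rewrite !inE; apply/negP => /andP[xS /imsetP[i]].
  by rewrite !inE => /andP[_ nS] E; rewrite -E xS in nS.
apply: stable_alpha; apply/stableP => x y.
move=> /setUP[xS|/imsetP[i iK ->]] /setUP[yS|/imsetP[j jK ->]] //.
- exact: sS.
- by rewrite inE in jK; case/andP: jK => jJ _; rewrite adj_sym nJ.
- by rewrite inE in iK; case/andP: iK => iJ _; rewrite nJ.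
Qed.

Section Glue.
Variables (T1 T2 I : finType) (G1 : sgraph T1) (G2 : sgraph T2).
Variables (u : I -> T1) (v : I -> T2).
Hypotheses (u_inj : injective u) (v_inj : injective v).
Hypothesis u_stable : forall i j, ~~ adj G1 (u i) (u j).
Hypothesis v_stable : forall i j, ~~ adj G2 (v i) (v j).
Hypotheses (tf1 : triangle_free G1) (tf2 : triangle_free G2).

Let cross x y := [exists i, (x == u i) && (y == v i)].

(** Each [u i] is joined to [v i], and the additional vertex [i] is a twin of [u i] towards [G1] and
    of [v i] towards [G2]. *)
Definition glue_rel : rel (T1 + T2 + I) := fun a b =>
  match a, b with
  | inl (inl x), inl (inl y) => adj G1 x y
  | inl (inr x), inl (inr y) => adj G2 x y
  | inl (inl x), inl (inr y) | inl (inr y), inl (inl x) => cross x y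
  | inl (inl x), inr i | inr i, inl (inl x) => adj G1 (u i) x
  | inl (inr y), inr i | inr i, inl (inr y) => adj G2 (v i) y
  | inr _, inr _ => false
  end.

Definition glue : sgraph (T1 + T2 + I)%type := rel_graph glue_rel.

Lemma adj_glue : adj glue =2 glue_rel.
Proof.
apply: adj_rel_graph; first by case=> [[x|x]|i] [[y|y]|j] //=; rewrite adj_sym.
by case=> [[x|x]|i] //=; rewrite adj_irrefl.
Qed.

Lemma glue_triangle_free : triangle_free glue.
Proof.
have s1 x y : adj G1 x y -> adj G1 y x by rewrite adj_sym.
have s2 x y : adj G2 x y -> adj G2 y x by rewrite adj_sym.
have t1 := elimT (triangle_freeP G1) tf1.
have t2 := elimT (triangle_freeP G2) tf2.
(* The cross edges form a matching, so no triangle uses two of them. A triangle through a cross edge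
   and an additional vertex would need adjacent vertices in the image of [u]. *)
have c1 x y z : cross x z -> cross y z -> adj G1 x y -> False.
  move=> /existsP[i /andP[/eqP-> /eqP->]] /existsP[j /andP[/eqP-> /eqP/v_inj->]].
  by rewrite adj_irrefl.
have c2 x y z : cross x y -> cross x z -> adj G2 y z -> False.
  move=> /existsP[i /andP[/eqP-> /eqP->]] /existsP[j /andP[/eqP/u_inj-> /eqP->]].
  by rewrite adj_irrefl.
have cm i x y : adj G1 (u i) x -> cross x y -> False.
  move=> ux /existsP[j /andP[/eqP xE _]]; move: ux; rewrite xE.
  exact/negP.
apply/triangle_freeP => a b c; rewrite !adj_glue.
case: a b c => [[x|x]|i] [[y|y]|j] [[z|z]|k] //= H1 H2 H3; eauto.
Qed.

(* If [inr i \in S] then [S] misses [u i] or [v i], as they are adjacent, and the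
   missing one could be added to the part of [S] in its own graph. *)
Lemma glue_stable (S : {set T1 + T2 + I}) :
  stable glue S -> #|S| <= alpha G1 + alpha G2.
Proof.
move=> /stableP st; have {}st a b : a \in S -> b \in S -> ~~ glue_rel a b.
  by move=> aS bS; rewrite -adj_glue st.
pose S1 := [set x | inl (inl x) \in S]; pose S2 := [set x | inl (inr x) \in S].
pose J := [set i | inr i \in S].
pose J1 := [set i in J | u i \notin S1]; pose J2 := [set i in J | v i \notin S2].
have leJ : #|J| <= #|J1| + #|J2|.
  apply: leq_trans (leq_card_setU _ _); apply: subset_leq_card.
  apply/subsetP => i iJ; rewrite !inE; move: iJ; rewrite inE => -> /=.
  rewrite -negb_and; apply/negP => /andP[ui vi]; have := st _ _ ui vi => /= /negP[].
  by apply/existsP; exists i; rewrite !eqxx.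
have le1 : #|S1| + #|J1| <= alpha G1.
  apply: stable_extend => // [|i x].
    by apply/stableP => x y; rewrite !inE => xS yS; apply: st xS yS.
  by rewrite !inE => iS xS; apply: st iS xS.
have le2 : #|S2| + #|J2| <= alpha G2.
  apply: stable_extend => // [|i x].
    by apply/stableP => x y; rewrite !inE => xS yS; apply: st xS yS.
  by rewrite !inE => iS xS; apply: st iS xS.
have l1 := leq_card_sum_set S; have l2 := leq_card_sum_set [set x | inl x \in S].
have E1 : [set x | inl x \in [set x | inl x \in S]] = S1 by apply/setP => x; rewrite !inE.
have E2 : [set x | inr x \in [set x | inl x \in S]] = S2 by apply/setP => x; rewrite !inE.
rewrite E1 E2 in l2; rewrite -/J in l1.
apply: (leq_trans l1); apply: (leq_trans (leq_add l2 leJ)).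
by rewrite addnACA; apply: leq_add.
Qed.

End Glue.

(** * Subadditivity of the minimum stability number *)

Lemma stable_embedding (T : finType) (G : sgraph T) b :
  b <= alpha G ->
  exists2 u : 'I_b -> T, injective u & forall i j, ~~ adj G (u i) (u j).
Proof.
have [S /stableP st <-] := alpha_attained G => le.
exists (fun i => enum_val (widen_ord le i)) => [i j /enum_val_inj/(congr1 val) /= /ord_inj //|i j].
by apply: st; apply: enum_valP.
Qed.

Lemma alpha_min_glue n1 n2 b :
  b <= alpha_min n1 -> b <= alpha_min n2 ->
  alpha_min (n1 + n2 + b) <= alpha_min n1 + alpha_min n2.
Proof.
have [G1 tf1 <-] := alpha_minP n1; have [G2 tf2 <-] := alpha_minP n2.
move=> /stable_embedding[u u_inj u_st] /stable_embedding[v v_inj v_st].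
have -> : n1 + n2 + b = #|{: 'I_n1 + 'I_n2 + 'I_b}| by rewrite !card_sum !card_ord.
by apply: (@alpha_min_le _ (glue G1 G2 u v));
  [apply: glue_triangle_free|move=> S; apply: glue_stable].
Qed.

Lemma alpha_min_add n1 n2 : alpha_min (n1 + n2) <= alpha_min n1 + alpha_min n2.
Proof. by have := @alpha_min_glue n1 n2 0 isT isT; rewrite addn0. Qed.

Lemma alpha_min_glue1 n1 n2 :
  0 < n1 -> 0 < n2 -> alpha_min (n1 + n2).+1 <= alpha_min n1 + alpha_min n2.
Proof.
move=> n1_gt0 n2_gt0; rewrite -addn1.
by apply: alpha_min_glue; rewrite alpha_min_gt0.
Qed.

Lemma alpha_min_add_le n k : alpha_min (n + k) <= alpha_min n + k.
Proof.
elim: k => [|k IH]; first by rewrite !addn0.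
have := alpha_min_add (n + k) 1; rewrite alpha_min1 addn1 -addnS; lia.
Qed.

Lemma alpha_min_glue_le n1 n2 a1 a2 b :
  alpha_min n1 <= a1 -> alpha_min n2 <= a2 -> b <= a1 -> b <= a2 ->
  alpha_min (n1 + n2 + b) <= a1 + a2.
Proof.
move=> le1 le2 b1 b2.
(* Glue with as many additional vertices as the true values allow. Each of the other [b - c]
   vertices costs at most one, which the slack in [a1] or [a2] covers. *)
pose c := minn b (minn (alpha_min n1) (alpha_min n2)).
have : alpha_min (n1 + n2 + c) <= alpha_min n1 + alpha_min n2.
  apply: alpha_min_glue; lia.
have := alpha_min_add_le (n1 + n2 + c) (b - c).
have -> : n1 + n2 + c + (b - c) = n1 + n2 + b by lia.
lia.
Qed.

(* Deleting a closed neighbourhood from the first graph loses at most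
   [alpha_min n1 + 1] vertices and lowers its stability number by one; the two
   gluings that follow win the vertices back. *)
Lemma alpha_min_add3_sorted n1 n2 n3 :
  0 < n1 -> 1 < alpha_min n2 ->
  alpha_min n1 <= alpha_min n2 -> alpha_min n2 <= alpha_min n3 ->
  (alpha_min (n1 + n2 + n3)).+1 <= alpha_min n1 + alpha_min n2 + alpha_min n3.
Proof.
move=> n1_gt0 gt1 le12 le23; have a1_gt0 := alpha_min_gt0 n1_gt0.
have rem := alpha_min_remove n1_gt0.
set m := n1 - _ in rem.
have g1 : alpha_min (m + n3 + (alpha_min n1).-1) <= (alpha_min n1).-1 + alpha_min n3.
  by apply: alpha_min_glue_le; lia.
have g2 : alpha_min (m + n3 + (alpha_min n1).-1 + n2 + alpha_min n2) <=
          (alpha_min n1).-1 + alpha_min n3 + alpha_min n2.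
  by apply: alpha_min_glue_le => //; lia.
(* Deletion followed by the first gluing loses at most two vertices; the second gluing regains them
   because [1 < alpha_min n2]. *)
have le : n1 + n2 + n3 <= m + n3 + (alpha_min n1).-1 + n2 + alpha_min n2 by lia.
have := leq_alpha_min le; lia.
Qed.

(** Oddness excludes the orders 0 and 2. Three orders equal to 2 would violate the bound, as
    [alpha_min 6] is 3. *)
Lemma alpha_min_add3 n1 n2 n3 :
  odd n1 -> odd n2 -> odd n3 ->
  (alpha_min (n1 + n2 + n3)).+1 <= alpha_min n1 + alpha_min n2 + alpha_min n3.
Proof.
wlog le12 : n1 n2 n3 / alpha_min n1 <= alpha_min n2.
  move=> H o1 o2 o3; have [le|le] := leqP (alpha_min n1) (alpha_min n2); first exact: H.
  by rewrite (addnC n1) (addnC (alpha_min n1)); apply: H => //; apply: ltnW.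
wlog le13 : n1 n2 n3 le12 / alpha_min n1 <= alpha_min n3.
  move=> H o1 o2 o3; have [le|le] := leqP (alpha_min n1) (alpha_min n3); first exact: H.
  have -> : n1 + n2 + n3 = n3 + n1 + n2 by lia.
  have : (alpha_min (n3 + n1 + n2)).+1 <= alpha_min n3 + alpha_min n1 + alpha_min n2.
    by apply: H => //; lia.
  lia.
wlog le23 : n2 n3 le12 le13 / alpha_min n2 <= alpha_min n3.
  move=> H o1 o2 o3; have [le|le] := leqP (alpha_min n2) (alpha_min n3); first exact: H.
  by rewrite -!addnA (addnC n2) (addnC (alpha_min n2)) !addnA; apply: H => //; apply: ltnW.
move=> o1 o2 o3; have [gt1|le1] := ltnP 1 (alpha_min n2).
  by apply: alpha_min_add3_sorted => //; lia.
(* The single vertex serves as the additional vertex in a gluing of the other two graphs. *)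
have n1E : n1 = 1 by have [/alpha_min_ge2|] := ltnP 2 n1; lia.
have : alpha_min (n2 + n3).+1 <= alpha_min n2 + alpha_min n3.
  by apply: alpha_min_glue1; lia.
rewrite n1E alpha_min1 -addnA add1n; lia.
Qed.

(** * Ramsey numbers and the correction term *)

Lemma ramsey3_propE m N : ramsey3_prop m N = (m <= alpha_min N).
Proof.
apply/forallP/idP => [H|le G].
  have [G tf <-] := alpha_minP N; have /orP[|/existsP[S /andP[st /eqP<-]]] := H G.
    by rewrite (negPf tf).
  exact: stable_alpha.
case: (boolP (has_triangle G)) => //= tf.
have [S [_ st leS]] := alpha_min_stable setT tf.
rewrite cardsT card_ord in leS.
have [S' st' cS'] := stable_card st (leq_trans le leS).
by apply/existsP; exists S'; rewrite st' cS' eqxx.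
Qed.

(** [R3 m] is the least [N] with [m <= alpha_min N], so Ramsey numbers are the jumps of [alpha_min].
    At [n = 0] both sides fail, the left one because [m] is positive. *)
Lemma ramsey_numberE n : ramsey_number n <-> alpha_min n.-1 < alpha_min n.
Proof.
rewrite /ramsey_number /R3; split=> [[m m_gt0]|lt].
  case: ex_minnP => N; rewrite ramsey3_propE => le minN <-.
  rewrite (leq_trans _ le) // ltnNge -ramsey3_propE; apply/negP => /minN.
  by case: N le {minN} => [|N]; [rewrite alpha_min0 leqNgt m_gt0|rewrite ltnn].
exists (alpha_min n); first exact: leq_ltn_trans lt.
case: ex_minnP => N; rewrite ramsey3_propE => le minN.
apply/eqP; rewrite eqn_leq minN ?ramsey3_propE //= leqNgt; apply/negP => ltN.
have /leq_alpha_min : N <= n.-1 by lia.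
lia.
Qed.

Lemma eps_le1 n : eps n <= 1.
Proof. by rewrite /eps; case: asboolP. Qed.

(** This merges the two cases of [eps]: an even Ramsey number splits off the summand 1. Conversely,
    a summand 1 makes [n] a Ramsey number and a summand 3 is impossible, so otherwise both summands
    are at least 5. *)
Lemma epsP n :
  reflect (exists p q, [/\ odd p, odd q, n = p + q &
                           alpha_min n = alpha_min p + alpha_min q])
          (eps n == 1).
Proof.
apply: (iffP idP) => [|[p [q [op oq nE aE]]]].
  rewrite /eps; case: asboolP => // -[[ev /ramsey_numberE lt] _|[_ [p [q [nE _ _ [op oq] aE]]]] _];
    last by exists p, q.
  case: n ev lt => [|n] /= ev; first by rewrite alpha_min0.
  exists n, 1; split=> //; [lia|lia|].
  have := alpha_min_add n 1; rewrite addn1 alpha_min1; lia.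
rewrite /eps; case: asboolP => // -[].
have ev : ~~ odd n by lia.
have [ram|ram] := ltnP (alpha_min n.-1) (alpha_min n).
  by left; split=> //; apply/ramsey_numberE.
have n_gt0 : 0 < n by lia.
have ge5 r s : odd r -> odd s -> n = r + s -> alpha_min n = alpha_min r + alpha_min s -> 5 <= r.
  move=> or os nE' aE'; rewrite leqNgt; apply/negP => r_lt5.
  have /orP[/eqP r1|/eqP r3] : (r == 1) || (r == 3) by lia.
    rewrite r1 alpha_min1 in aE'; have sE : n.-1 = s by lia.
    rewrite sE in ram; lia.
  (* Gluing an edge to the graph of order [s] with one more vertex adds three vertices and raises
     the stability number by at most one, whereas [alpha_min 3] is at least 2. *)
  have : alpha_min (s + 2).+1 <= alpha_min s + alpha_min 2 by apply: alpha_min_glue1; lia.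
  have -> : (s + 2).+1 = n by lia.
  have := alpha_min2; have : 1 < alpha_min r by apply: alpha_min_ge2; lia.
  lia.
right; split; first by move=> [_ /ramsey_numberE]; lia.
exists p, q; split=> //; first exact: (ge5 p q).
by apply: (ge5 q p) => //; lia.
Qed.

Lemma eps_cases n :
  eps n = 0 \/ exists p q, [/\ odd p, odd q, n = p + q, eps n = 1 &
                           alpha_min n = alpha_min p + alpha_min q].
Proof.
have := eps_le1 n; case: (boolP (eps n == 1)) => [e1 _|]; last by left; lia.
right; have [p [q [op oq nE aE]]] := epsP _ e1.
by exists p, q; split=> //; apply/eqP.
Qed.

Lemma odd_eps0 n : odd n -> eps n = 0.
Proof. by case: (eps_cases n) => // -[p [q [op oq -> _ _]]]; lia. Qed.

(** * Superadditivity of the gap formula *)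

(** For odd summands [uphalf p + uphalf q] exceeds half the sum by one. Either [alpha_min] is
    strictly subadditive here, or [eps (p + q)] makes up for it. *)
Lemma gap_formula_odd p q : odd p -> odd q ->
  (p + q)./2.+1 + alpha_min (p + q) <=
  (p + q)./2 + eps (p + q) + alpha_min p + alpha_min q.
Proof.
move=> op oq; have sub := alpha_min_add p q.
have [eq|ne] := eqVneq (alpha_min (p + q)) (alpha_min p + alpha_min q); last by lia.
have /eqP -> : eps (p + q) == 1 by apply/epsP; exists p, q.
lia.
Qed.

(* The function [uphalf n + eps n - alpha_min n] is superadditive, stated
   without subtraction. When [eps n = 1] its value at [n] is the sum of its
   values at two odd summands of [n], so only odd summands and summands with
   [eps n = 0] matter. *)
Lemma gap_formula_superadditive m n :
  uphalf m + eps m + (uphalf n + eps n) + alpha_min (m + n) <=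
  uphalf (m + n) + eps (m + n) + (alpha_min m + alpha_min n).
Proof.
have sub := alpha_min_add m n.
case: (eps_cases m) => [em|[p [q [op oq mE em am]]]];
  case: (eps_cases n) => [en|[r [s [or os nE en an]]]].
- case om : (odd m); last by lia.
  case on : (odd n); last by lia.
  have := gap_formula_odd om on; lia.
- have sub1 := alpha_min_add m r.
  case om : (odd m).
    have := alpha_min_add3 om or os; have -> : m + r + s = m + n by lia.
    lia.
  have omr : odd (m + r) by lia.
  have := gap_formula_odd omr os; have -> : m + r + s = m + n by lia.
  lia.
- have sub1 := alpha_min_add p n.
  case on : (odd n).
    have := alpha_min_add3 op oq on; have -> : p + q + n = m + n by lia.
    lia.
  have opn : odd (p + n) by lia.
  have := gap_formula_odd opn oq; have -> : p + n + q = m + n by lia.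
  lia.
- have := alpha_min_add3 op oq or.
  have opqr : odd (p + q + r) by lia.
  have := gap_formula_odd opqr os; have -> : p + q + r + s = m + n by lia.
  lia.
Qed.

(** * Matchings and Gallai's lemma *)

Section Matching.
Variables (T : finType) (G : sgraph T).
Implicit Types (A B S E : {set T}) (M N : {set {set T}}).

(** The vertex set [A] is a parameter so that the induction over induced subgraphs stays inside one
    graph. *)
Definition matching A M := [&& M \subset edges G, trivIset M & cover M \subset A].

Lemma edge_card E : E \in edges G -> #|E| = 2.
Proof. by move=> EG; apply/eqP; apply: (forall_inP (edges_card2 G)). Qed.

Lemma edgeP E x : E \in edges G -> x \in E -> exists2 y, adj G x y & E = [set x; y].
Proof.
move=> EG xE; have := edge_card EG; rewrite (cardsD1 x) xE => -[] /eqP/cards1P[y yE].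
have EE : E = [set x; y] by rewrite -(setD1K xE) yE.
by exists y => //; rewrite /adj -EE.
Qed.

Lemma card_cover_matching A M : matching A M -> #|cover M| = #|M|.*2.
Proof.
move=> /and3P[/subsetP sM /eqP<- _].
rewrite (eq_bigr (fun=> 2)) => [|E /sM]; last exact: edge_card.
by rewrite sum_nat_const muln2.
Qed.

Lemma matchingS A B M : A \subset B -> matching A M -> matching B M.
Proof. by move=> sAB /and3P[? ? sM]; apply/and3P; split=> //; apply: subset_trans sAB. Qed.

Lemma matching0 A : matching A set0.
Proof.
by rewrite /matching sub0set /cover big_set0 sub0set andbT /=; apply/trivIsetP => E; rewrite inE.
Qed.

Lemma matchingU A B M N : [disjoint A & B] -> matching A M -> matching B N ->
  matching (A :|: B) (M :|: N) /\ #|M :|: N| = #|M| + #|N|.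
Proof.
move=> dAB /and3P[sM tM cM] /and3P[sN tN cN].
have dMN E F : E \in M -> F \in N -> [disjoint E & F].
  move=> EM FN; apply: disjointWl (disjointWr _ dAB).
    by apply: subset_trans cM; apply: bigcup_sup.
  by apply: subset_trans cN; apply: bigcup_sup.
split.
  apply/and3P; split; first by rewrite subUset sM.
    apply/trivIsetP => E F /setUP[EM|EN] /setUP[FM|FN] ne.
    - exact: (trivIsetP tM).
    - exact: dMN.
    - by rewrite disjoint_sym; apply: dMN.
    - exact: (trivIsetP tN).
  by rewrite /cover bigcup_setU; apply: setUSS.
rewrite cardsU; have -> : M :&: N = set0; last by rewrite cards0 subn0.
apply/setP => E; rewrite !inE; apply/negP => /andP[EM EN].
have := dMN _ _ EM EN; rewrite -setI_eq0 setIid => /eqP E0.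
by have := edge_card (subsetP sM _ EM); rewrite E0 cards0.
Qed.

Lemma matchingD1 A M E : E \in M -> matching A M ->
  matching (A :\: E) (M :\ E).
Proof.
move=> EM /and3P[sM tM cM]; apply/and3P; split.
- exact: subset_trans (subsetDl _ _) sM.
- by apply/trivIsetP => F F' /setD1P[_ FM] /setD1P[_ FM']; apply: (trivIsetP tM).
apply/bigcupsP => F /setD1P[ne FM]; rewrite subsetD.
rewrite (subset_trans _ cM) /=; last exact: bigcup_sup.
exact: (trivIsetP tM).
Qed.

Lemma matching1 x y : adj G x y -> matching [set x; y] [set [set x; y]].
Proof.
move=> xy; apply/and3P; split; first by rewrite sub1set.
  by apply/trivIsetP => E F /set1P-> /set1P->; rewrite eqxx.
by rewrite /cover big_set1.
Qed.

Lemma matching_cover A M : matching A M -> matching (cover M) M.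
Proof. by move=> /and3P[? ? ?]; apply/and3P. Qed.

Definition max_matching A M :=
  matching A M && [forall M', matching A M' ==> (#|M'| <= #|M|)].

Lemma max_matchingP A M :
  reflect (matching A M /\ forall M', matching A M' -> #|M'| <= #|M|) (max_matching A M).
Proof.
apply: (iffP andP) => -[mM H]; split=> //.
  by move=> M'; apply/implyP; apply: (forallP H).
by apply/forallP => M'; apply/implyP/H.
Qed.

Lemma max_matching_exists A : exists M, max_matching A M.
Proof.
have [M mM H] := arg_maxnP (fun M => #|M|) (matching0 A).
by exists M; apply/max_matchingP.
Qed.

(** Otherwise the edge could be added to [M]. *)
Lemma max_matching_adj A M x y : max_matching A M -> x \in A -> y \in A ->
  adj G x y -> x \notin cover M -> y \in cover M.
Proof.
move=> /max_matchingP[mM H] xA yA xy xM; apply/negPn/negP => yM.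
have dis : [disjoint cover M & [set x; y]].
  by rewrite disjoint_sym disjoints_subset subUset !sub1set !inE xM.
have [mM' cM'] := matchingU dis (matching_cover mM) (matching1 xy).
have: matching A (M :|: [set [set x; y]]).
  apply: matchingS mM'; rewrite !subUset !sub1set xA yA !andbT.
  by case/and3P: mM.
by move=> /H; rewrite cM' cards1 addn1 ltnn.
Qed.

(* Gallai's lemma: among the maximum matchings that miss [t], one sharing the
   most edges with [M] already misses [u] or [v], since otherwise it could
   exchange an edge for one of [M]. *)
Lemma max_matching_miss A M u t v :
  max_matching A M -> u \in A -> v \in A -> t \in A -> u != v ->
  u \notin cover M -> v \notin cover M ->
  (exists2 N, max_matching A N & t \notin cover N) ->
  exists2 N, max_matching A N &
    t \notin cover N /\ ((u \notin cover N) || (v \notin cover N)).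
Proof.
move=> xM uA vA tA uv uM vM [N0 xN0 tN0].
pose P N := max_matching A N && (t \notin cover N).
have P0 : P N0 by rewrite /P xN0.
have [N /andP[xN tN] maxN] := arg_maxnP (fun N => #|M :&: N|) P0.
exists N => //; split=> //; rewrite -negb_and; apply/negP => /andP[uN vN].
have [/max_matchingP[mM HM] /max_matchingP[mN HN]] := (xM, xN).
have eqMN : #|M| = #|N| by apply/eqP; rewrite eqn_leq HM // HN.
have cMN : #|cover M| = #|cover N| by rewrite (card_cover_matching mM) (card_cover_matching mN) eqMN.
(* The two covers have equal size and [N] covers [u] and [v], which [M] misses; so [M] covers at
   least two vertices that [N] misses, one of them other than [t]. *)
have gt1 : 1 < #|cover M :\: cover N|.
  have := cardsID (cover N) (cover M); have := cardsID (cover M) (cover N).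
  rewrite setIC -cMN => <- /eqP; rewrite eqn_add2l => /eqP->.
  apply: leq_trans (_ : #|[set u; v]| <= _); first by rewrite cards2 uv.
  by apply: subset_leq_card; rewrite subUset !sub1set !inE uM vM uN vN.
have [x xt /setDP[xcM xcN]] : exists2 x, x != t & x \in cover M :\: cover N.
  have : 0 < #|(cover M :\: cover N) :\ t|.
    move: gt1; rewrite (cardsD1 t); case: (t \in _) => //=.
    by rewrite add0n; apply: ltnW.
  by move=> /card_gt0P[x /setD1P[]]; exists x.
have [E EM xE] := bigcupP xcM.
have [/and3P[sM tM sMA] /and3P[sN tN' sNA]] := (mM, mN).
have [y xy EE] := edgeP (subsetP sM _ EM) xE.
have xA : x \in A by apply: (subsetP sMA).
have yA : y \in A by apply: (subsetP sMA); apply/bigcupP; exists E; rewrite // EE set22.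
have yN := max_matching_adj xN xA yA xy xcN.
(* Replace [F] by [E] in [N]. The new matching still misses [t] and gains an edge of [M]; the lost
   edge [F] is not in [M], since it meets [E] in [y] only. *)
have [F FN yF] := bigcupP yN.
have xF : x \notin F by apply: contra xcN => xF; apply/bigcupP; exists F.
have yt : y != t by apply: contraTneq yN => ->.
have mF := matching_cover (matchingD1 FN mN).
have cND : cover (N :\ F) \subset cover N.
  by apply/bigcupsP => D /setD1P[_ DN]; apply: bigcup_sup.
have dis : [disjoint cover (N :\ F) & E].
  rewrite disjoint_sym disjoints_subset EE subUset !sub1set !inE.
  rewrite (contra (subsetP cND x) xcN) /=.
  case/and3P: (matchingD1 FN mN) => _ _ /subsetP sD.
  by apply/negP => /sD; rewrite inE yF.
have mE : matching E [set E] by rewrite EE; apply: matching1.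
have [mN' cN'] := matchingU dis mF mE.
set N' := N :\ F :|: [set E] in mN' cN'.
have cardN' : #|N'| = #|N|.
  by rewrite cN' cards1 (cardsD1 F N) FN addnC.
have sub' : cover (N :\ F) :|: E \subset A :\ t.
  rewrite subUset !subsetD (subset_trans cND sNA) /=.
  rewrite (disjoint_sym _ [set t]) disjoints1 (contra (subsetP cND t) tN) /=.
  rewrite EE subUset !sub1set xA yA (disjoint_sym _ [set t]) disjoints1 !inE.
  by rewrite negb_or eq_sym xt eq_sym yt.
have {}mN' := matchingS sub' mN'.
have PN' : P N'.
  apply/andP; split.
    apply/max_matchingP; split=> [|M' mM']; last by rewrite cardN' HN.
    exact: matchingS (subsetDl _ _) mN'.
  by case/and3P: mN' => _ _ /subsetP sN'; apply/negP => /sN'; rewrite !inE eqxx.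
have FM : F \notin M.
  apply/negP => FM; have : [disjoint E & F].
    by apply: (trivIsetP tM) => //; apply: contraNneq xF => <-.
  by move=> /pred0P/(_ y); rewrite /= EE set22 yF.
have EN : E \notin N.
  by apply: contra xcN => EN; apply/bigcupP; exists E.
have le : #|M :&: N'| <= #|M :&: N| := maxN _ PN'.
suff : #|M :&: N| < #|M :&: N'| by rewrite ltnNge le.
apply: proper_card; apply/properP; split.
  apply/subsetP => D /setIP[DM DN]; rewrite !inE DM DN andbT /=.
  by apply/orP; left; apply: contraNneq FM => <-.
by exists E; rewrite !inE EM ?eqxx ?orbT // (negPf EN).
Qed.

End Matching.

(** * The upper bound by induction over induced subgraphs *)

Section UpperBound.
Variables (T : finType) (G : sgraph T).
Hypothesis tf : triangle_free G.
Implicit Types (A B S : {set T}) (M : {set {set T}}).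

(** The inequality bounds [#|A| - #|M| - #|S|] by the gap formula at [#|A|], with subtraction
    cleared. *)
Definition gap_bounded A := exists M S,
  [/\ matching G A M, stable G S, S \subset A &
      #|A| + alpha_min #|A| <= uphalf #|A| + eps #|A| + #|M| + #|S|].

Lemma gap_bounded_split A B : B \subset A ->
  (forall x y, x \in B -> y \in A :\: B -> ~~ adj G x y) ->
  gap_bounded B -> gap_bounded (A :\: B) -> gap_bounded A.
Proof.
move=> sBA no [M [S [mM sS SB leM]]] [N [R [mN sR RC leN]]].
have dis : [disjoint B & A :\: B].
  by rewrite -setI_eq0 setIDA setIC setDIl setDv setI0.
have AE : B :|: (A :\: B) = A by rewrite -[RHS](setID A B) (setIidPr sBA).
have [mMN cMN] := matchingU dis mM mN; rewrite AE in mMN.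
exists (M :|: N), (S :|: R); split=> //.
- apply/stableP => x y /setUP[xS|xR] /setUP[yS|yR].
  + exact: (stableP _ _ sS).
  + by apply: no; [apply: (subsetP SB)|apply: (subsetP RC)].
  + by rewrite adj_sym; apply: no; [apply: (subsetP SB)|apply: (subsetP RC)].
  + exact: (stableP _ _ sR).
- by rewrite -AE; apply: setUSS.
have cSR : #|S :|: R| = #|S| + #|R|.
  rewrite cardsU; have -> : S :&: R = set0; last by rewrite cards0 subn0.
  by apply/eqP; rewrite setI_eq0; apply: disjointWl SB (disjointWr RC dis).
have cA : #|A| = #|B| + #|A :\: B| by rewrite -(cardsID B A) (setIidPr sBA).
have := gap_formula_superadditive #|B| #|A :\: B|.
rewrite cMN cSR cA; move: leM leN.
move: #|B| #|A :\: B| #|M| #|N| #|S| #|R| => b c m n s r; lia.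
Qed.

(** Restoring [v] adds one vertex and at least one matching edge, since no maximum matching of [A]
    avoids [v]. The formula does not decrease, its value at 1 being 0. *)
Lemma gap_bounded_covered A v : v \in A ->
  (forall M, max_matching G A M -> v \in cover M) ->
  gap_bounded (A :\ v) -> gap_bounded A.
Proof.
move=> vA cov [M [S [mM sS SA leM]]].
have [N /[dup] xN /max_matchingP[mN HN]] := max_matching_exists G A.
have mMA : matching G A M := matchingS (subsetDl _ _) mM.
have lt : #|M| < #|N|.
  rewrite ltn_neqAle HN // andbT; apply: contraTneq isT => eqMN.
  have: v \in cover M by apply: cov; apply/max_matchingP; split=> //; rewrite eqMN.
  by case/and3P: mM => _ _ /subsetP/[apply]; rewrite !inE eqxx.
exists N, S; split=> //; first exact: subset_trans SA (subsetDl _ _).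
have cA : #|A| = 1 + #|A :\ v| by rewrite (cardsD1 v A) vA.
have := gap_formula_superadditive 1 #|A :\ v|; rewrite alpha_min1 (odd_eps0 (n := 1)) //.
rewrite cA; move: leM lt; move: #|A :\ v| #|M| #|N| #|S| => a m n s /=; lia.
Qed.

Lemma gap_boundedP A : gap_bounded A.
Proof.
have [k] := ubnP #|A|; elim: k A => // k IH A ltk.
have [->|[u uA]] := set_0Vmem A.
  exists set0, set0; split; rewrite ?matching0 ?sub0set //.
    by apply/stableP => x; rewrite inE.
  by rewrite cards0 alpha_min0.
have IHD B : B \subset A -> B != set0 -> gap_bounded (A :\: B).
  move=> sBA B0; apply: IH; rewrite -card_gt0 in B0.
  by rewrite cardsDS //; have := subset_leq_card sBA; lia.
case: (boolP [exists v in A, [forall M, max_matching G A M ==> (v \in cover M)]]).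
  move=> /exists_inP[v vA /forallP cov]; apply: (gap_bounded_covered vA).
    by move=> M; apply/implyP.
  by apply: IHD; rewrite ?sub1set // -card_gt0 cards1.
move=> /exists_inPn missed.
have {}missed v : v \in A -> exists2 M, max_matching G A M & v \notin cover M.
  by move=> /missed /forallPn[M]; rewrite negb_imply => /andP[]; exists M.
pose together v := [exists M, [&& max_matching G A M, u \notin cover M & v \notin cover M]].
(* [B] consists of [u] and the vertices that no maximum matching misses together with [u]. *)
pose B := [set v in A | (v == u) || ~~ together v].
have sBA : B \subset A by apply/subsetP => v; rewrite inE => /andP[].
have uB : u \in B by rewrite inE uA eqxx.
have closed x y : x \in B -> y \in A :\: B -> ~~ adj G x y.
  rewrite !inE => /andP[xA xu] /andP[+ yA]; rewrite yA /= negb_or negbK.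
  move=> /andP[yu /existsP[M /and3P[xM uM yM]]]; apply/negP => xy.
  have [xE|xNu] := eqVneq x u.
    by rewrite (max_matching_adj xM xA yA xy) ?xE in yM.
  (* By Gallai's lemma some maximum matching misses [x] and one of [u], [y]. Missing [u] contradicts
     the choice of [B]; missing [y] leaves both ends of an edge uncovered. *)
  have [N xN [xcN /orP[uN|yN]]] :=
    max_matching_miss xM uA yA xA (etrans (congr1 negb (eq_sym _ _)) yu) uM yM (missed x xA).
    move: xu; rewrite (negPf xNu) /= => /existsPn/(_ N).
    by rewrite xN uN xcN.
  by rewrite (max_matching_adj xN xA yA xy xcN) in yN.
have [AB|AB] := eqVneq (A :\: B) set0; last first.
  apply: (gap_bounded_split sBA closed); last first.
    by apply: IHD => //; apply/set0Pn; exists u.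
  have -> : B = A :\: (A :\: B) by rewrite setDDr setDv set0U; apply/esym/setIidPr.
  by apply: IHD; rewrite ?subsetDl.
(* Now [B] is all of [A], so a maximum matching that misses [u] misses nothing else. *)
have [M xM uM] := missed u uA; have /max_matchingP[mM _] := xM.
have [S [SA sS leS]] := alpha_min_stable A tf.
exists M, S; split=> //.
have : A :\ u \subset cover M.
  apply/subsetP => v /setD1P[vu vA]; apply/negPn/negP => vM.
  have : v \in B by apply: contraTT isT => vB; have := in_set0 v; rewrite -AB inE vB vA.
  rewrite inE vA (negPf vu) /= => /existsPn/(_ M).
  by rewrite xM uM vM.
move=> /subset_leq_card; rewrite (card_cover_matching mM).
have : #|A| = 1 + #|A :\ u| by rewrite (cardsD1 u A) uA.
move: leS; move: #|A| #|A :\ u| #|M| #|S| => a b m s; lia.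
Qed.

End UpperBound.

(** * Clique covers and matchings *)

Section CliqueCover.
Variables (T : finType) (G : sgraph T).
Implicit Types (A K : {set T}) (M P : {set {set T}}).

Lemma theta_le P : clique_cover G P -> theta G <= #|P|.
Proof.
move=> cP; rewrite /theta; case: arg_minnP => [|Q _ H]; first exact: singletons_clique_cover.
exact: H.
Qed.

Lemma theta_attained : exists2 P, clique_cover G P & #|P| = theta G.
Proof.
rewrite /theta; case: arg_minnP => [|Q cQ _]; first exact: singletons_clique_cover.
by exists Q.
Qed.

Lemma cliqueP K :
  reflect {in K &, forall x y, x != y -> adj G x y} (clique G K).
Proof.
apply: (iffP forall_inP) => [H x y /H/forall_inP xK /xK/implyP //|H x xK].
by apply/forall_inP => y yK; apply/implyP/H.
Qed.

(** The edges of [M] and the singletons of the uncovered vertices form a clique cover. *)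
Lemma theta_matching A M : matching G A M -> theta G + #|M| <= #|T|.
Proof.
move=> mM; have cM := card_cover_matching mM; case/and3P: mM => /subsetP sM tM _.
pose Q := [set [set x] | x in ~: cover M]; pose P := M :|: Q.
have cQ : #|Q| = #|~: cover M| by rewrite card_imset //; apply: set1_inj.
have QM x K : x \in ~: cover M -> K \in M -> [disjoint [set x] & K].
  rewrite inE disjoints1 => xM KM; apply: contra xM => xK.
  by apply/bigcupP; exists K.
have cP : clique_cover G P.
  apply/andP; split.
    apply/and3P; split.
    - apply/eqP/setP => x; rewrite [RHS]inE; apply/bigcupP.
      case: (boolP (x \in cover M)) => [/bigcupP[K KM xK]|xM].
        by exists K; rewrite // inE KM.
      by exists [set x]; rewrite ?set11 // inE; apply/orP; right; apply: imset_f; rewrite inE.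
    - apply/trivIsetP => K L /setUP[KM|/imsetP[x xM ->]] /setUP[LM|/imsetP[y yM ->]] ne.
      + exact: (trivIsetP tM).
      + by rewrite disjoint_sym; apply: QM.
      + exact: QM.
      + by rewrite disjoints1 inE; apply: contra ne => /eqP->.
    - apply/negP => /setUP[/sM/edge_card|/imsetP[x _ /setP/(_ x)]]; first by rewrite cards0.
      by rewrite !inE eqxx.
  apply/forall_inP => K /setUP[KM|/imsetP[x _ ->]]; apply/cliqueP => y z.
    move=> yK zK; have [w yw KE] := edgeP (sM _ KM) yK.
    by move: zK; rewrite KE => /set2P[]-> //; rewrite eqxx.
  by move=> /set1P-> /set1P->; rewrite eqxx.
have := theta_le cP; have : #|P| <= #|M| + #|Q| by exact: leq_card_setU.
have := cardsC (cover M); rewrite cQ cM; move: #|P| #|M| #|~: cover M| #|T| (theta G) => p m c t h.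
lia.
Qed.

Hypothesis tf : triangle_free G.

Lemma clique_card K : clique G K -> #|K| <= 2.
Proof.
move=> /cliqueP cK; rewrite leqNgt; apply/negP => /card_gt2P[x [y [z [[xK yK zK] [xy yz zx]]]]].
apply: (elimT (triangle_freeP G) tf x y z); first exact: cK.
  exact: cK.
by apply: cK; rewrite // eq_sym.
Qed.

(** No clique meets both sides, and each has at most two vertices, so rounding up happens on each
    side separately. *)
Lemma theta_ge A : (forall x y, x \in A -> y \notin A -> ~~ adj G x y) ->
  uphalf #|A| + uphalf #|~: A| <= theta G.
Proof.
move=> no; have [P /andP[/and3P[/eqP cP tP _] /forall_inP qP] <-] := theta_attained.
pose meet (B : {set T}) := [set K in P | ~~ [disjoint K & B]].
have half (B : {set T}) : uphalf #|B| <= #|meet B|.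
  have sub : B \subset cover (meet B).
    apply/subsetP => x xB; have : x \in cover P by rewrite cP.
    move=> /bigcupP[K KP xK]; apply/bigcupP; exists K => //; rewrite inE KP.
    by apply/pred0Pn; exists x; rewrite /= xK.
  have : #|B| <= #|meet B| * 2.
    apply: leq_trans (subset_leq_card sub) _; apply: leq_trans (leq_card_cover _) _.
    rewrite -sum_nat_const; apply: leq_sum => K; rewrite inE => /andP[KP _].
    exact/clique_card/qP.
  move: #|B| #|meet B| => a b; lia.
apply: leq_trans (leq_add (half A) (half (~: A))) _.
rewrite -cardsUI; have -> : meet A :&: meet (~: A) = set0.
  apply/setP => K; rewrite !inE; apply/negP => /andP[/andP[KP nA] /andP[_ nC]].
  have /pred0Pn[x /andP[/= xK xA]] := nA; have /pred0Pn[y /andP[/= yK yA]] := nC.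
  rewrite inE in yA; have /cliqueP cK := qP _ KP.
  have := no _ _ xA yA; rewrite cK //; by apply: contraTneq xA => ->.
rewrite cards0 addn0; apply: subset_leq_card.
by apply/subsetP => K; rewrite !inE => /orP[]/andP[].
Qed.

End CliqueCover.

(** * Extremal graphs and the gap formula *)

Lemma gap2_ge n (G : sgraph 'I_n) : triangle_free G -> (gap G <= gap2 n)%R.
Proof.
move=> tfG; rewrite /gap2; case: Order.TotalTheory.arg_maxP => [|H _ le].
  exact: edgeless_triangle_free.
exact: le.
Qed.

Lemma gap2_attained n : exists2 G : sgraph 'I_n, triangle_free G & gap G = gap2 n.
Proof.
rewrite /gap2; case: Order.TotalTheory.arg_maxP => [|H tfH _].
  exact: edgeless_triangle_free.
by exists H.
Qed.

Lemma exists_disjoint_union p q :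
  exists2 G : sgraph 'I_(p + q), triangle_free G &
    alpha G <= alpha_min p + alpha_min q /\ uphalf p + uphalf q <= theta G.
Proof.
have [G1 tf1 <-] := alpha_minP p; have [G2 tf2 <-] := alpha_minP q.
(* Gluing along the empty index type gives the disjoint union, to which [glue_stable] applies. *)
pose V := ('I_p + 'I_q + void)%type.
have cV : #|{: V}| = p + q by rewrite !card_sum !card_ord card_void addn0.
pose H : sgraph V := glue G1 G2 (@of_void _) (@of_void _).
have tfH : triangle_free H by apply: glue_triangle_free => // -[].
pose g (i : 'I_(p + q)) : V := enum_val (cast_ord (esym cV) i).
have g_bij : bijective g.
  exists (fun x => cast_ord cV (enum_rank x)) => x.
    by rewrite /g enum_valK cast_ordKV.
  by rewrite /g cast_ordK enum_rankK.
have tfG := pullback_triangle_free g tfH.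
exists (pullback g H) => //; split.
  apply/alpha_leP => S; rewrite stable_pullback => st.
  rewrite -(card_imset S (bij_inj g_bij)).
  by apply: (glue_stable _ _ _ _ st) => // -[].
pose A : {set V} := [set x : V | if x is inl (inl _) then true else false].
have cA : #|g @^-1: A| = p.
  rewrite on_card_preimset; last exact: onW_bij.
  have -> : A = [set inl (inl i) | i : 'I_p].
    apply/setP => -[[i|j]|[]]; rewrite inE; first by rewrite imset_f.
    by apply/esym/imsetP => -[].
  by rewrite card_imset ?card_ord // => i j [].
have cC : #|~: (g @^-1: A)| = q.
  by have := cardsC (g @^-1: A); rewrite cA card_ord => /addnI.
have := @theta_ge _ _ tfG (g @^-1: A); rewrite cA cC; apply.
move=> x y; rewrite !inE adj_pullback adj_glue.
by case: (g x) => [[i|j]|[]] //; case: (g y) => [[k|l]|[]] //= _ _; apply/existsP => -[[]].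
Qed.

Theorem theorem4p1 (n : nat) (n_gt0 : 0 < n) :
  gap2 n = ((uphalf n)%:Z - (alpha_min n)%:Z + (eps n)%:Z)%R.
Proof.
have upper : (gap2 n <= (uphalf n)%:Z - (alpha_min n)%:Z + (eps n)%:Z)%R.
  have [G tfG <-] := gap2_attained n.
  have [M [S [mM sS _]]] := gap_boundedP tfG setT.
  rewrite cardsT card_ord; have := theta_matching mM; rewrite card_ord.
  have := stable_alpha sS; rewrite /gap.
  by move: #|M| #|S| (theta G) (alpha G) => m s t a; lia.
have lower p q : p + q = n -> alpha_min p + alpha_min q = alpha_min n ->
    ((uphalf p)%:Z + (uphalf q)%:Z - (alpha_min n)%:Z <= gap2 n)%R.
  move=> <- <-; have [G tfG []] := exists_disjoint_union p q.
  have := gap2_ge tfG; rewrite /gap.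
  by move: (theta G) (alpha G) => t a; lia.
(* The second graph is empty if [eps n = 0]; otherwise the two odd orders gain one by rounding up
   twice. *)
case: (eps_cases n) => [e0|[p [q [op oq nE e1 aE]]]].
  by have := lower n 0 (addn0 n); rewrite alpha_min0 addn0 => /(_ erefl); lia.
by have := lower p q (esym nE) (esym aE); lia.
Qed.
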